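(* Let $(V,g)$ be an inner product vector space over $k$, with $k=\mathbb{R}$ or $k=\mathbb{C}$ (possibly infinite-dimensional). The general core order $<^{(\#)}$ is a pre-order (reflexive and transitive) on the set $\operatorname{End}_k^{fp}(V)$ of all finite potent endomorphisms of $V$.
   Context: An endomorphism $\varphi$ of $V$ is finite potent if $\varphi^n(V)$ is finite-dimensional for some $n$. Equivalently, there is a (unique) $\varphi$-invariant decomposition $V=W_\varphi\oplus U_\varphi$ (AST-decomposition) with $\varphi|_{U_\varphi}$ nilpotent, $W_\varphi$ finite-dimensional and $\varphi|_{W_\varphi}$ an automorphism of $W_\varphi$. The index $i(\varphi)$ is the nilpotency order of $\varphi|_{U_\varphi}$; $i(\varphi)\le 1$ iff $W_\varphi=\operatorname{Im}(\varphi)$ iff $U_\varphi=\operatorname{Ker}(\varphi)$. Every finite potent $\varphi$ has a unique CN-decomposition $\varphi=\varphi_1+\varphi_2$ with $\varphi_1,\varphi_2$ finite potent, $i(\varphi_1)\le1$, $\varphi_2$ nilpotent and $\varphi_1\circ\varphi_2=\varphi_2\circ\varphi_1=0$; explicitly $\varphi_1=\varphi$ on $W_\varphi$ and $0$ on $U_\varphi$, while $\varphi_2=0$ on $W_\varphi$ and $\varphi_2=\varphi$ on $U_\varphi$. For $\theta$ finite potent with $i(\theta)\le 1$ one has $V=\operatorname{Im}(\theta)\oplus[\operatorname{Im}(\theta)]^{\perp}$, and the core inverse $\theta^{(\#)}$ is the unique linear map with $\theta\circ\theta^{(\#)}=P_{\operatorname{Im}(\theta)}$ (the orthogonal projection onto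 $\operatorname{Im}(\theta)$ induced by this decomposition) and $\operatorname{Im}(\theta^{(\#)})\subseteq\operatorname{Im}(\theta)$. For finite potent $\theta,\eta$ of index $\le1$, the core order $\theta\leq^{(\#)}\eta$ means $\theta\circ\theta^{(\#)}=\eta\circ\theta^{(\#)}$ and $\theta^{(\#)}\circ\theta=\theta^{(\#)}\circ\eta$. For finite potent $\varphi,\psi$ with CN-decompositions $\varphi=\varphi_1+\varphi_2$, $\psi=\psi_1+\psi_2$, the general core order $\varphi<^{(\#)}\psi$ means $\varphi_1\leq^{(\#)}\psi_1$. *)

(* Defs.v *)
From HB Require Import structures.
From mathcomp Require Import all_boot all_order all_algebra.
From mathcomp Require Import complex.
From mathcomp Require Import boolp classical_sets functions reals.

Set Implicit Arguments.
Unset Strict Implicit.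
Unset Printing Implicit Defensive.

Import GRing.Theory Num.Theory.

Local Open Scope classical_set_scope.
Local Open Scope ring_scope.

Section FinitePotent.
Context {K : fieldType} {V : lmodType K}.
Implicit Types (A W U : set V) (phi : {linear V -> V}) (n : nat).

Definition span (s : seq V) : set V :=
  range (fun c : 'I_(size s) -> K => \sum_i c i *: s`_i).

Definition finite_dim A := exists s : seq V, A = span s.

Definition finite_potent phi := exists n, finite_dim (range (iter n phi)).

Definition direct_sum W U :=
  W `&` U = [set 0] /\ forall v, exists2 w, W w & exists2 u, U u & v = w + u.

Definition nilpotent_on U phi n := forall u, U u -> iter n phi u = 0.

Definition AST_decomposition phi W U :=
  [/\ submod_closed (mem W), submod_closed (mem U) & direct_sum W U] /\
  [/\ finite_dim W, set_bij W W phi,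
      (forall u, U u -> U (phi u)) & exists n, nilpotent_on U phi n].

(* The order of nilpotency of the restriction to U is 0 exactly when U = 0. *)
Definition has_index phi n :=
  exists W U, [/\ AST_decomposition phi W U, nilpotent_on U phi n &
                  forall m, nilpotent_on U phi m -> (n <= m)%N].

Definition index_le1 phi := exists2 n, has_index phi n & (n <= 1)%N.

Definition nilpotent phi := exists n, nilpotent_on [set: V] phi n.

Definition CN_decomposition (phi phi1 phi2 : {linear V -> V}) :=
  [/\ finite_potent phi1, finite_potent phi2, index_le1 phi1 & nilpotent phi2]
  /\ [/\ phi =1 phi1 \+ phi2,
         phi1 \o phi2 =1 cst 0 & phi2 \o phi1 =1 cst 0].

End FinitePotent.

Section CoreOrder.
Context {K : numFieldType} {theta : K -> K} {V : lmodType K}.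
Variable g : {dot V for theta}.
Implicit Types (A : set V) (f h : {linear V -> V}).

Definition orthogonal_complement A : set V :=
  [set x | forall y, A y -> g x y = 0].

Definition is_orthogonal_projection A (P : V -> V) :=
  forall v, A (P v) /\ orthogonal_complement A (v - P v).

Definition is_core_inverse f f' :=
  is_orthogonal_projection (range f) (f \o f') /\ range f' `<=` range f.

(* Core inverses are unique, and exist when f is finite potent of index at
   most 1; the relation is only meant for such f and h. *)
Definition core_le f h :=
  exists f' : {linear V -> V},
    [/\ is_core_inverse f f', f \o f' =1 h \o f' & f' \o f =1 f' \o h].

(* CN-decompositions of finite potent endomorphisms exist and are unique. *)
Definition general_core_le (phi psi : {linear V -> V}) :=
  exists phi1 phi2 psi1 psi2 : {linear V -> V},
    [/\ CN_decomposition phi phi1 phi2, CN_decomposition psi psi1 psi2 &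
        core_le phi1 psi1].

End CoreOrder.

Definition preorder_on T (A : set T) (r : T -> T -> Prop) :=
  (forall x, A x -> r x x) /\
  (forall x y z, A x -> A y -> A z -> r x y -> r y z -> r x z).

(* Main.v *)
Require Import Defs.
From mathcomp Require Import all_boot all_order all_algebra.
From mathcomp Require Import complex.
From mathcomp Require Import boolp classical_sets functions reals.
From HB Require Import structures.

(* If f has index at most 1, then f is bijective on its finite-dimensional
   range, and a core inverse f' inverts f there and kills the orthogonal
   complement of that range. Hence f <= h gives range f <= range h and
   f' = f' h h', from which transitivity of the core order is a computation.
   For phi with CN-decomposition (phi1, phi2), the large iterates of phi and
   phi1 agree; they determine the range and the kernel of phi1, hence phi1, so
   two CN-decompositions of one endomorphism have the same core part.
   Reflexivity amounts to the existence of the CN-decomposition, and of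
   the core inverse via orthogonal projection on a finite-dimensional space. *)

Set Implicit Arguments.
Unset Strict Implicit.
Unset Printing Implicit Defensive.

Import Order.TTheory GRing.Theory Num.Theory.

Local Open Scope classical_set_scope.
Local Open Scope ring_scope.

Local Notation span := Defs.span.

(** * Subspaces, spans and linear dependence *)

Section LinearAlgebra.
Context {K : fieldType} {V : lmodType K}.
Implicit Types (A W U : set V) (phi f : {linear V -> V}) (s : seq V).

Definition subspace A :=
  A 0 /\ forall a u v, A u -> A v -> A (a *: u + v).

Lemma subspaceE A : submod_closed (mem A) <-> subspace A.
Proof.
split=> -[A0 AL]; split; rewrite ?in_setE // in A0 *.
  by move=> a u v Au Av; have := AL a u v; rewrite !in_setE; apply.
by move=> a u v; rewrite !in_setE; apply: AL.
Qed.

Section SubspaceTheory.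
Variables (A : set V) (subA : subspace A).

Lemma subspaceD u v : A u -> A v -> A (u + v).
Proof. by rewrite -{2}[u]scale1r; apply: subA.2. Qed.

Lemma subspaceZ a u : A u -> A (a *: u).
Proof.
by move=> Au; rewrite -[_ *: _]addr0; apply: subA.2 => //; case: subA.
Qed.

Lemma subspaceB u v : A u -> A v -> A (u - v).
Proof. by move=> Au Av; rewrite addrC -scaleN1r; apply: subA.2. Qed.

Lemma subspace_sum I (r : seq I) (P : pred I) (F : I -> V) :
  (forall i, P i -> A (F i)) -> A (\sum_(i <- r | P i) F i).
Proof.
move=> AF; elim/big_rec: _ => [|i x Pi Ax]; first by case: subA.
by apply: subspaceD => //; apply: AF.
Qed.

End SubspaceTheory.

Lemma subspace_range f : subspace (range f).
Proof.
split=> [|a _ _ [x _ <-] [y _ <-]]; first by exists 0; rewrite // linear0.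
by exists (a *: x + y); rewrite // linearP.
Qed.

Lemma subspace_ker f : subspace [set x | f x = 0].
Proof.
split=> [|a u v /= fu fv]; rewrite /= ?linear0 //.
by rewrite linearP fu fv scaler0 addr0.
Qed.

Lemma subspace_span s : subspace (span s).
Proof.
split.
  by exists (fun=> 0) => //; rewrite big1 // => i _; rewrite scale0r.
move=> a _ _ [c _ <-] [d _ <-]; exists (fun i => a * c i + d i) => //.
rewrite scaler_sumr -big_split /=; apply: eq_bigr => i _.
by rewrite scalerDl scalerA.
Qed.

Lemma mem_span s x : x \in s -> span s x.
Proof.
move=> xs; have ix : (index x s < size s)%N by rewrite index_mem.
exists (fun i => (i == Ordinal ix)%:R) => //.
rewrite (bigD1 (Ordinal ix)) //= eqxx scale1r nth_index // big1 ?addr0 //.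
by move=> i /negPf->; rewrite scale0r.
Qed.

Lemma span_sub A s : subspace A -> {in s, forall x, A x} -> span s `<=` A.
Proof.
move=> subA sA _ [c _ <-]; apply: subspace_sum => // i _.
by apply: subspaceZ => //; apply: sA; rewrite mem_nth.
Qed.

Lemma image_span f s : f @` span s = span (map f s).
Proof.
apply/seteqP; split.
  move=> _ [_ [c _ <-] <-]; rewrite linear_sum.
  apply: subspace_sum => [|i _]; first exact: subspace_span.
  rewrite linearZ; apply: subspaceZ; first exact: subspace_span.
  by apply: mem_span; rewrite map_f // mem_nth.
apply: span_sub => [|_ /mapP[x xs ->]]; last by exists x => //; exact: mem_span.
split=> [|a _ _ [x xs <-] [y ys <-]].
  by exists 0; rewrite ?linear0 //; case: (subspace_span s).
by exists (a *: x + y); [apply: (subspace_span s).2|rewrite linearP].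
Qed.

(** A vector with nonzero coefficient in a linear relation is a combination of the others, so it can
    be deleted from the list. *)
Lemma span_shorten s (c : 'I_(size s) -> K) i :
  \sum_j c j *: s`_j = 0 -> c i != 0 ->
  exists2 s', (size s' < size s)%N & span s' = span s.
Proof.
move=> c0 ci; pose s' := take i s ++ drop i.+1 s.
have mem_s' (j : 'I_(size s)) : j != i -> s`_j \in s'.
  rewrite mem_cat -val_eqE /= neq_ltn => /orP[ltji|ltij]; apply/orP.
    by left; rewrite -(nth_take _ ltji) mem_nth // size_take ltn_ord.
  right; rewrite -(subnKC ltij) -nth_drop mem_nth // size_drop ltn_sub2r //.
  exact: leq_ltn_trans ltij (ltn_ord j).
exists s'.
  rewrite size_cat size_take size_drop ltn_ord.
  by rewrite -[X in (_ < X)%N](subnKC (ltn_ord i)) addSn ltnS.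
apply/seteqP; split; apply: span_sub; try exact: subspace_span.
  by move=> x; rewrite mem_cat => /orP[/mem_take|/mem_drop]; apply: mem_span.
move=> x xs; have ix : (index x s < size s)%N by rewrite index_mem.
rewrite -(nth_index 0 xs); have [ei|] := eqVneq (Ordinal ix) i; last first.
  by move=> /mem_s' /mem_span.
rewrite -[index x s]/(val (Ordinal ix)) ei.
move: c0; rewrite (bigD1 i) //= => /eqP; rewrite addr_eq0 => /eqP e.
have -> : s`_i = (- (c i)^-1) *: \sum_(j < size s | j != i) c j *: s`_j.
  by rewrite scaleNr -scalerN -e scalerA mulVf ?scale1r.
apply: subspaceZ; first exact: subspace_span.
apply: subspace_sum => [|j /mem_s'/mem_span]; first exact: subspace_span.
by apply: subspaceZ; apply: subspace_span.
Qed.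

(** Injectivity gives the matrix of [f] in the free family [s] a trivial left kernel; the matrix is
    square, hence invertible, and its inverse yields preimages. *)
Lemma span_sub_image f s :
  f @` span s `<=` span s -> (forall w, span s w -> f w = 0 -> w = 0) ->
  (forall c : 'I_(size s) -> K, \sum_i c i *: s`_i = 0 -> forall i, c i = 0) ->
  span s `<=` f @` span s.
Proof.
move=> fs inj_f free_s.
(* Row [i] of the matrix holds coordinates of the image of the [i]-th vector, so [f] acts on
   coordinate rows by right multiplication. *)
have /choice[M Me] (i : 'I_(size s)) :
    exists c : 'I_(size s) -> K, \sum_j c j *: s`_j = f s`_i.
  have [|c _ <-] := fs (f s`_i); last by exists c.
  by exists s`_i => //; apply: mem_span; rewrite mem_nth.
have fsum (u : 'rV[K]_(size s)) :
    f (\sum_i u 0 i *: s`_i)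
      = \sum_j (u *m \matrix_(i, j) M i j) 0 j *: s`_j.
  rewrite linear_sum /=; under eq_bigr => i _ do
    rewrite linearZ /= -Me scaler_sumr.
  rewrite exchange_big; apply: eq_bigr => j _; rewrite mxE scaler_suml.
  by apply: eq_bigr => i _; rewrite mxE scalerA.
have uM : \matrix_(i, j) M i j \in unitmx.
  rewrite -row_free_unit.
  apply: inj_row_free => u uM0; apply/rowP => i; rewrite mxE.
  apply: (free_s (fun i => u 0 i)); apply: inj_f; first by exists (u 0).
  by rewrite fsum uM0 big1 // => j _; rewrite mxE scale0r.
move=> _ [c _ <-]; set u := (\row_i c i) *m invmx (\matrix_(i, j) M i j).
exists (\sum_i u 0 i *: s`_i); first by exists (u 0).
by rewrite fsum mulmxKV //; apply: eq_bigr => i _; rewrite mxE.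
Qed.

(** * Iterates, index at most 1, and existence of the CN-decomposition *)

Lemma iter_linearP phi n a u v :
  iter n phi (a *: u + v) = a *: iter n phi u + iter n phi v.
Proof. by elim: n => //= n ->; rewrite linearP. Qed.

Lemma iter_linear0 phi n : iter n phi 0 = 0.
Proof. by elim: n => //= n ->; rewrite linear0. Qed.

Lemma iter_linearB phi n u v : iter n phi (u - v) = iter n phi u - iter n phi v.
Proof. by rewrite addrC -scaleN1r iter_linearP scaleN1r addrC. Qed.

Lemma range_iterS phi n : range (iter n.+1 phi) = phi @` range (iter n phi).
Proof. by rewrite image_comp. Qed.

(** The last two conditions say that kernels and ranges of the iterates stop changing at [n]; for
    [n] equal to 1 this will characterize index at most 1. *)
Definition bijective_on_range n phi :=
  [/\ finite_dim (range (iter n phi)),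
      forall x, iter n.+1 phi x = 0 -> iter n phi x = 0 &
      range (iter n phi) `<=` range (iter n.+1 phi)].

(* A range of an iterate spanned by as few vectors as possible: one more
   application of phi cannot lower that number, so phi is injective there. *)
Lemma finite_potent_bijective_on_range phi :
  finite_potent phi -> exists n, bijective_on_range n phi.
Proof.
case=> n0 [s0 es0].
have ex_k : exists k,
    `[< exists n s, size s = k /\ range (iter n phi) = span s >].
  by exists (size s0); apply/asboolP; exists n0, s0.
have [] := ex_minnP ex_k => k /asboolP[n [s [<- es]]] min_s.
have free (m : nat) t : range (iter m phi) = span t -> (size t <= size s)%N ->
    forall c : 'I_(size t) -> K, \sum_i c i *: t`_i = 0 -> forall i, c i = 0.
  move=> et ts c c0 i; apply/eqP/negP => /negP ci.
  have [t' lt_t' et'] := span_shorten c0 ci.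
  have := leq_trans lt_t' ts; rewrite ltnNge min_s //.
  by apply/asboolP; exists m, t'; split; rewrite ?et'.
have eS : range (iter n.+1 phi) = span (map phi s).
  by rewrite range_iterS es image_span.
(* If [phi] kills a combination of [s], the same coefficients give a relation in [map phi s], which
   is free by minimality since it has the length of [s]. *)
have inj w : span s w -> phi w = 0 -> w = 0.
  move=> [c _ <-] p0; have := @free _ _ eS.
  rewrite size_map => /(_ (leqnn _) c) c0.
  rewrite big1 // => i _; rewrite c0 ?scale0r // -[RHS]p0 linear_sum.
  by apply: eq_bigr => j _; rewrite linearZ /= (nth_map 0).
exists n; split; first by exists s.
  by move=> x; apply: inj; rewrite -es; exists x.
rewrite range_iterS es; apply: span_sub_image => //; last exact: (free n).
rewrite -es -range_iterS => _ [x _ <-]; exists (phi x) => //.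
by rewrite iterSr.
Qed.

(** Index at most 1 makes [f] vanish on [U], so its range is [W]. Conversely, range and kernel of
    [f] form an AST-decomposition. *)
Lemma index_le1P f : index_le1 f <-> bijective_on_range 1 f.
Proof.
split.
  case=> n [W [U [[[_ _ [_ WU]] [fW bijW _ _]] nU _]]] n1.
  have fU u : U u -> f u = 0.
    (* For index 0 the zeroth iterate, the identity, vanishes on [U], so [u] itself is 0. *)
    case: n n1 nU => [|[]] // _ nU Uu; last exact: nU.
    by have /= -> := nU u Uu; rewrite linear0.
  have fWU w u : U u -> f (w + u) = f w.
    by move=> Uu; rewrite linearD (fU u) ?addr0.
  have rW : range f = W.
    apply/seteqP; split=> [_ [v _ <-]|w Ww].
      have [w Ww [u Uu ->]] := WU v; rewrite fWU //.
      by have [fun_f _ _] := bijW; apply: fun_f.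
    by have [_ _ /(_ _ Ww)[x Wx <-]] := bijW; exists x.
  have W0 : W 0 by rewrite -rW; case: (subspace_range f).
  have [funW injW surW] := bijW; split => /=; first by rewrite rW.
    move=> x ffx0; have Wfx : W (f x) by rewrite -rW; exists x.
    by apply: injW; rewrite ?in_setE // linear0.
  rewrite [X in X `<=` _]rW => w /surW[x Wx <-].
  by have /surW[y Wy <-] := Wx; exists y.
case=> fr inj sur.
have ast : AST_decomposition f (range f) [set x | f x = 0].
  split; split.
  - exact/subspaceE/subspace_range.
  - exact/subspaceE/subspace_ker.
  - split=> [|v].
      apply/seteqP; split=> [_ [[x _ <-] /= /inj]//|_ ->].
      by split; [exists 0; rewrite // linear0|rewrite /= linear0].
    have [|x _ /= e] := sur (f v); first by exists v.
    exists (f x); first by exists x.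
    exists (v - f x); last by rewrite addrC subrK.
    by rewrite /= linearB e subrr.
  - exact: fr.
  - split=> [_ [x _ <-]|x y|_ /sur[x _ <-]].
    + by exists (f x).
    + rewrite !in_setE => -[x' _ <-] [y' _ <-] /eqP.
      rewrite -subr_eq0 -!linearB => /eqP/inj /= /eqP.
      by rewrite linearB subr_eq0 => /eqP.
    + by exists (f x) => //; exists x.
  - by move=> u /= ->; rewrite linear0.
  - by exists 1%N => u.
(* The exact index is 0 if the kernel is trivial, and 1 otherwise. *)
have [inj0|/existsNP[x /not_implyP[fx nx]]] :=
    pselect (forall x, f x = 0 -> x = 0).
  by exists 0%N => //; exists (range f), [set x | f x = 0]; split.
exists 1%N => //; exists (range f), [set x | f x = 0]; split=> //.
by case=> // /(_ x fx).
Qed.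

(** Linearity of [r] and the condition at 0 make any choice function linear. Projections and core
    inverses can thus be defined by their specification. *)
Lemma linear_relation_map (r : V -> V -> Prop) :
  (forall v, exists w, r v w) -> (forall w, r 0 w -> w = 0) ->
  (forall a u v x y, r u x -> r v y -> r (a *: u + v) (a *: x + y)) ->
  exists f : {linear V -> V}, forall v, r v (f v).
Proof.
move=> /choice[F rF] r0 rL.
have linF : linear F.
  move=> a u v; apply/eqP; rewrite -subr_eq0; apply/eqP/r0.
  have := rL (-1) _ _ _ _ (rL a _ _ _ _ (rF u) (rF v)) (rF (a *: u + v)).
  by rewrite !scaleN1r addNr [X in r _ X]addrC.
pose FL := GRing.isLinear.Build K V V *:%R F linF.
pose f : {linear V -> V} := HB.pack F FL.
by exists f => v; apply: rF.
Qed.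

Lemma CN_decomposition_exists phi :
  finite_potent phi -> exists phi1 phi2, CN_decomposition phi phi1 phi2.
Proof.
case/finite_potent_bijective_on_range=> n [fr inj sur].
have injm m x : iter (m + n) phi x = 0 -> iter n phi x = 0.
  elim: m x => // m IHm x; rewrite addSnnS addnC.
  move=> e; apply: inj; move: e; rewrite [(_ + m)%N]addnC addnS iterSr => /IHm.
  by rewrite iterSr.
have surm m : range (iter n phi) `<=` range (iter (m + n) phi).
  elim: m => // m IHm; apply: subset_trans sur _.
  by rewrite addSn !range_iterS; apply: image_subset.
(* [w] is the component of [v] in the stable range along the stable kernel. The resulting projection
   [pi] commutes with [phi], and the two parts are [phi] after [pi] and [phi] after its
   complement. *)
pose r v w := range (iter n phi) w /\ iter n phi (v - w) = 0.
have r0 w : r 0 w -> w = 0.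
  move=> [[x _ <-]]; rewrite sub0r -sub0r iter_linearB iter_linear0 sub0r.
  by move/eqP; rewrite oppr_eq0 -iterD => /eqP /injm.
have rL a u v x y : r u x -> r v y -> r (a *: u + v) (a *: x + y).
  move=> [[x' _ <-] ex] [[y' _ <-] ey]; split.
    by exists (a *: x' + y'); rewrite // iter_linearP.
  rewrite opprD addrACA -scalerBr iter_linearP ex ey.
  by rewrite scaler0 addr0.
have [v|pi rpi] := linear_relation_map _ r0 rL.
  have /(surm n)[z _ ez] : range (iter n phi) (iter n phi v) by exists v.
  exists (iter n phi z); split; first by exists z.
  by rewrite iter_linearB -iterD ez subrr.
have pi_uniq v w : r v w -> pi v = w.
  move=> rw; apply/eqP; rewrite -subr_eq0; apply/eqP/r0.
  have := rL (-1) _ _ _ _ rw (rpi v).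
  by rewrite !scaleN1r addNr [X in r _ X]addrC.
have pi_phi v : pi (phi v) = phi (pi v).
  apply: pi_uniq; have [[x _ ex] e] := rpi v; split.
    by rewrite -ex -iterS iterSr; exists (phi x).
  by rewrite -linearB -iterSr iterS e linear0.
have pi_sub v : pi (v - pi v) = 0.
  apply: pi_uniq; have [_ e] := rpi v; split; last by rewrite subr0.
  by exists 0; rewrite // iter_linear0.
have pi_id v : pi (pi v) = pi v.
  by apply/eqP; rewrite eq_sym -subr_eq0 -linearB pi_sub.
have pi_range y : pi (iter n phi y) = iter n phi y.
  by apply: pi_uniq; split; [exists y|rewrite subrr iter_linear0].
pose phi1 : {linear V -> V} := phi \o pi.
pose phi2 : {linear V -> V} := phi \o (idfun \- pi).
have rphi1 : range phi1 = range (iter n phi).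
  apply/seteqP; split=> [_ [v _ <-] /=|].
    by rewrite -pi_phi; case: (rpi (phi v)).
  move=> _ /sur[x _ <-]; exists (iter n phi x) => //=.
  by rewrite pi_range.
(* As [pi] commutes with [phi] and kills [v - pi v], it corrects nothing after the first step. The
   zeroth iterate is excluded, since it returns [v]. *)
have phi2E m v : iter m.+1 phi2 v = iter m.+1 phi (v - pi v).
  elim: m => // m IHm; rewrite iterS IHm [RHS]iterS /=; congr (phi _).
  rewrite -[X in _ - X]/(pi (iter m.+1 phi (v - pi v))).
  suff -> : pi (iter m.+1 phi (v - pi v)) = 0 by rewrite subr0.
  by elim: m.+1 => //= k IHk; rewrite pi_phi IHk linear0.
have nil2 v : iter n.+1 phi2 v = 0.
  by rewrite phi2E iterS; have [_ ->] := rpi v; rewrite linear0.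
exists phi1, phi2; split; split.
- by exists 1%N; rewrite /= rphi1.
- exists n.+1, [::]; rewrite -[LHS]/(range (iter n.+1 phi2)).
  apply/seteqP; split=> [_ [v _ <-]|_ [c _ <-]].
    by rewrite nil2; case: (subspace_span [::]).
  by exists 0; rewrite ?nil2 // big1 // => -[].
- apply/index_le1P; split=> /=; first by rewrite rphi1.
    move=> x /=; rewrite pi_phi pi_id; have [[y _ <-] _] := rpi x.
    by rewrite -iterS iterSr => /inj; rewrite -iterSr.
  move=> _ [x _ <-] /=; have [/sur[y _ ey] _] := rpi x.
  by exists (iter n phi y) => //=; rewrite pi_phi pi_id pi_range -ey.
- by exists n.+1.
- by move=> v /=; rewrite -linearD addrC subrK.
- by move=> v /=; rewrite pi_phi pi_sub !linear0.
- by move=> v /=; rewrite pi_phi pi_id subrr linear0.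
Qed.

End LinearAlgebra.

(** * Uniqueness of the core part *)

Section CNUniqueness.
Context {K : fieldType} {V : lmodType K}.
Implicit Types phi f : {linear V -> V}.

(** The mixed products vanish, so a positive power of [phi] is the sum of the powers of its parts,
    and the nilpotent one eventually dies. *)
Lemma CN_decomposition_iter phi phi1 phi2 : CN_decomposition phi phi1 phi2 ->
  exists n, forall m, (n <= m)%N -> iter m.+1 phi =1 iter m.+1 phi1.
Proof.
case=> -[_ _ _ [n nil]] [phiE phi12 phi21]; exists n => m nm v.
have phi2_iter k : phi2 (iter k.+1 phi1 v) = 0 by apply: phi21.
have phi1_iter k : phi1 (iter k.+1 phi2 v) = 0 by apply: phi12.
have -> : iter m.+1 phi v = iter m.+1 phi1 v + iter m.+1 phi2 v.
  elim: m {nm} => [|m IHm]; first exact: phiE.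
  rewrite iterS IHm phiE /= -!iterS !linearD /=.
  by rewrite [phi2 (phi1 _)]phi2_iter [phi1 (phi2 _)]phi1_iter addr0 add0r.
have -> : iter m.+1 phi2 v = 0.
  by rewrite -(subnK (leqW nm)) iterD nil // iter_linear0.
by rewrite addr0.
Qed.

Lemma index_le1_ker_iter f n x :
  index_le1 f -> iter n.+1 f x = 0 -> f x = 0.
Proof.
move=> /index_le1P[_ inj _]; elim: n x => // n IHn x.
by rewrite iterSr => /IHn; apply: inj.
Qed.

Lemma index_le1_range_iter f n :
  index_le1 f -> range f `<=` range (iter n.+1 f).
Proof.
move=> /index_le1P[_ _ sur]; elim: n => // n IHn.
apply: subset_trans sur _.
rewrite [X in X `<=` _]range_iterS [X in _ `<=` X]range_iterS.
exact: image_subset.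
Qed.

Lemma index_le1_inj_range f x y :
  index_le1 f -> range f x -> range f y -> f x = f y -> x = y.
Proof.
move=> /index_le1P[_ inj _] rx ry /eqP; rewrite -subr_eq0 -linearB => /eqP fxy.
apply/eqP; rewrite -subr_eq0; apply/eqP.
have [z _ ez] := subspaceB (subspace_range f) rx ry.
by rewrite -ez; apply: inj; rewrite /= ez.
Qed.

Lemma CN_decomposition_uniq phi phi1 phi2 psi1 psi2 :
  CN_decomposition phi phi1 phi2 -> CN_decomposition phi psi1 psi2 ->
  phi1 =1 psi1.
Proof.
move=> dphi dpsi v.
have [n en] := CN_decomposition_iter dphi.
have [m em] := CN_decomposition_iter dpsi.
pose k := maxn n m.
have ek : iter k.+1 phi1 =1 iter k.+1 psi1.
  by move=> x; rewrite -en ?leq_maxl // em ?leq_maxr.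
have [[_ _ i1 _] [phiE1 _ phi21]] := dphi.
have [[_ _ j1 _] [phiE2 _ psi21]] := dpsi.
have phi_range x : phi (phi1 x) = phi1 (phi1 x).
  by rewrite phiE1 /= [phi2 _]phi21 addr0.
have psi_range x : phi (psi1 x) = psi1 (psi1 x).
  by rewrite phiE2 /= [psi2 _]psi21 addr0.
have [_ _ sur] := (index_le1P phi1).1 i1.
have [|x _ /= ex] := sur (phi1 v); first by exists v.
have [|y _ ey] := @index_le1_range_iter phi1 k i1 (phi1 x); first by exists x.
(* [v - phi1 x] is killed by [phi1], hence by the common power of [phi1] and [psi1], hence by
   [psi1]. *)
have -> : psi1 v = psi1 (phi1 x).
  apply/eqP; rewrite -subr_eq0 -linearB; apply/eqP.
  apply: (index_le1_ker_iter (n := k) j1); rewrite -ek iterSr linearB /= ex.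
  by rewrite subrr iter_linear0.
(* [phi1 x] is a value of the common power, so it lies in both ranges, where [phi1] and [psi1] each
   agree with [phi]. *)
by rewrite -ex -phi_range -ey ek iterS psi_range.
Qed.

End CNUniqueness.

(** * Orthogonal projection and existence of core inverses *)

Section CoreOrderTheory.
Context {K : numFieldType} {theta : K -> K} {V : lmodType K}.
Variable g : {dot V for theta}.
Implicit Types (A : set V) (f h : {linear V -> V}).

Lemma subspace_orthogonal A : subspace (orthogonal_complement g A).
Proof.
split=> [y _|a u v Au Av y Ay]; first by rewrite linear0l.
by rewrite linearDl linearZl_LR /= Au // Av // mulr0 addr0.
Qed.

Lemma subspace_orthogonal_to x : subspace [set y | g x y = 0].
Proof.
split=> [|a u v /= gu gv]; first by rewrite /= linear0r.
by rewrite /= linearDr linearZr_LR /= gu gv mulr0 addr0.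
Qed.

Lemma dot_eq0 x : g x x = 0 -> x = 0.
Proof.
move=> gx; apply/eqP/negP => /negP /(neq0_dnorm_gt0 (s := g)).
by rewrite gx ltxx.
Qed.

Lemma orthogonal_meet0 A x : A x -> orthogonal_complement g A x -> x = 0.
Proof. by move=> Ax /(_ x Ax) /dot_eq0. Qed.

(* Gram-Schmidt *)
Lemma orthogonal_projection_exists s v :
  exists2 p, span s p & orthogonal_complement g (span s) (v - p).
Proof.
elim: s v => [|x s IHs] v.
  exists 0; first by case: (subspace_span ([::] : seq V)).
  by move=> _ [c _ <-]; rewrite big1 ?linear0r // => -[].
have sub := subspace_span (x :: s).
have sub_s : span s `<=` span (x :: s).
  by apply: span_sub => // y ys; apply: mem_span; rewrite inE ys orbT.
have [p sp op] := IHs x; have [q sq oq] := IHs v.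
pose y := x - p; pose c := g (v - q) y / g y y.
exists (q + c *: y).
  apply: subspaceD => //; [exact: sub_s|apply: subspaceZ => //].
  by apply: subspaceB => //; [apply: mem_span; rewrite mem_head|exact: sub_s].
have ort z : span s z -> g (v - (q + c *: y)) z = 0.
  move=> sz; rewrite opprD addrA linearBl linearZl_LR /= oq // op //.
  by rewrite mulr0 subr0.
have orty : g (v - (q + c *: y)) y = 0.
  rewrite opprD addrA linearBl linearZl_LR /=.
  (* The degenerate case is [y = 0], that is, [x] already in the span of [s]. *)
  have [/dot_eq0->|gy] := eqVneq (g y y) 0.
    by rewrite !linear0r mulr0 subr0.
  by rewrite /c divfK // subrr.
apply: (span_sub (subspace_orthogonal_to _)) => z.
rewrite inE => /orP[/eqP->|zs]; last exact/ort/mem_span.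
rewrite -[x](subrK p).
by apply: (subspaceD (subspace_orthogonal_to _)) => //; apply: ort.
Qed.

Lemma core_inverse_exists f :
  index_le1 f -> exists f', is_core_inverse g f f'.
Proof.
move=> /index_le1P[[s es] inj sur].
(* The core inverse sends [v] to the vector of the range of [f] that [f] maps to the orthogonal
   projection of [v]. *)
pose r v w := range f w /\ orthogonal_complement g (range f) (v - f w).
have [v|w|a u v x y|f' rf'] := @linear_relation_map _ _ r.
- have [p] := orthogonal_projection_exists s v; rewrite -es => /sur[x _ <-] o.
  by exists (f x); split; first by exists x.
- case=> -[x _ <-]; rewrite sub0r => o; apply: inj.
  apply: (@orthogonal_meet0 (range f)); first by exists (f x).
  by have := subspaceZ (subspace_orthogonal _) (-1) o; rewrite scaleN1r opprK.
- move=> [rx ox] [ry oy]; split; first by apply: (subspace_range f).2.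
  rewrite linearP opprD addrACA -scalerBr.
  exact: (subspace_orthogonal _).2.
- exists f'; split=> [v|_ [v _ <-]]; last by case: (rf' v).
  by split; [exists (f' v)|case: (rf' v)].
Qed.

Lemma core_le_refl f : index_le1 f -> core_le g f f.
Proof. by case/core_inverse_exists=> f' ?; exists f'. Qed.

(** * Core inverses on the range and its complement; transitivity *)

Section Transitivity.
Variables (f f' : {linear V -> V}).
Hypotheses (f1 : index_le1 f) (cf : is_core_inverse g f f').

Lemma core_inverse_range v : range f (f' v).
Proof. by apply: cf.2; exists v. Qed.

Lemma core_inverse_projK x : f (f' (f x)) = f x.
Proof.
have [rP oP] := cf.1 (f x); apply/esym/eqP; rewrite -subr_eq0; apply/eqP.
apply: orthogonal_meet0 oP.
by apply: subspaceB => //; exact: subspace_range.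
Qed.

Lemma core_inverseK w : range f w -> f' (f w) = w.
Proof.
move=> rw; apply: (index_le1_inj_range f1) => //.
  exact: core_inverse_range.
exact: core_inverse_projK.
Qed.

Lemma core_inverse_orthogonal v :
  orthogonal_complement g (range f) v -> f' v = 0.
Proof.
move=> ov; apply: (index_le1_inj_range f1); first exact: core_inverse_range.
  by case: (subspace_range f).
rewrite linear0; have [rP oP] := cf.1 v; apply: orthogonal_meet0 rP _.
by have := subspaceB (subspace_orthogonal _) ov oP; rewrite subKr.
Qed.

End Transitivity.

Lemma core_le_trans f h k : index_le1 f -> index_le1 h ->
  core_le g f h -> core_le g h k -> core_le g f k.
Proof.
move=> f1 h1 [f' [cf ff' f'f]] [h' [ch hh' h'h]]; exists f'.
have fh : range f `<=` range h.
  move=> _ [x _ <-]; rewrite -(core_inverse_projK cf).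
  by rewrite [f (f' _)]ff'; exists (f' (f x)).
(* [v - h (h' v)] is orthogonal to the range of [h], hence to that of [f], and [f'] kills it. *)
have f'E v : f' v = f' (h (h' v)).
  apply/eqP; rewrite -subr_eq0 -linearB; apply/eqP.
  apply: (core_inverse_orthogonal f1 cf) => y /fh ry.
  by have [_] := ch.1 v; apply.
split=> // v /=.
  (* [f' v] lies in the range of [h], so it equals [h' (h (f' v))], and [h] and [k] agree on values
     of [h']. *)
  have /fh rv := core_inverse_range cf v.
  rewrite [f _]ff' /= -(core_inverseK h1 ch rv).
  by rewrite -[RHS]hh' /= core_inverse_projK.
by rewrite [RHS]f'E -[h' (k v)]h'h /= (core_inverse_projK ch) -[RHS]f'f.
Qed.

Lemma eq_core_le f h h' : h =1 h' -> core_le g f h -> core_le g f h'.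
Proof.
move=> eh [f' [cf ff' f'f]]; exists f'; split=> // v /=.
  by rewrite -eh; apply: ff'.
by rewrite -eh; apply: f'f.
Qed.

Lemma general_core_le_preorder :
  preorder_on [set phi | finite_potent phi] (general_core_le g).
Proof.
split=> [phi /CN_decomposition_exists[phi1 [phi2 d]]|phi psi chi _ _ _].
  exists phi1, phi2, phi1, phi2; split=> //; apply: core_le_refl.
  by case: d => -[].
move=> [f [f2 [h [h2 [df dh fh]]]]] [h' [h2' [k [k2 [dh' dk hk]]]]].
(* The two hypotheses may come with different CN-decompositions of [psi]; uniqueness lets [h']
   replace [h]. *)
exists f, f2, k, k2; split=> //; apply: (core_le_trans (h := h')) hk.
- by case: df => -[].
- by case: dh' => -[].
- exact: eq_core_le (CN_decomposition_uniq dh dh') fh.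
Qed.

End CoreOrderTheory.

Theorem theorem6p3 (R : realType) :
  (forall (V : lmodType R) (g : {dot V for idfun}),
     preorder_on [set phi : {linear V -> V} | finite_potent phi]%classic
       (general_core_le g)) /\
  (forall (V : lmodType R[i]) (g : {dot V for Num.conj}),
     preorder_on [set phi : {linear V -> V} | finite_potent phi]%classic
       (general_core_le g)).
Proof. by split=> V g; apply: general_core_le_preorder. Qed.
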